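(* Let $0<\alpha<1$, $\beta,\gamma,\delta\ge 0$, and let $n_0\ge 0$ be an integer. Let $(p(n))_{n\in\mathbb{N}}$ be a bounded real sequence and, for each integer $n>n_0$, let $Y(n)$ be a random variable with values in $\{0,1,\ldots,n-1\}$ such that for all $n>n_0$ $$p(n)=\mathbb{E}[p(Y(n))],\qquad |\mathbb{E}[Y(n)]-\alpha n|\le\beta,\qquad \operatorname{Var}(Y(n))\le\gamma n+\delta .$$ For every real $x>0$ put $N_i=[\alpha^{-i}x]$, $i\ge 0$. Then for every real $x>0$ there exist intervals $I_0\subset I_1\subset I_2\subset\cdots$ (depending on $x$ but not on $i$), centered at $x$ and having length of order $\sqrt{x}$, and a positive decreasing sequence $(q_k)_{k\ge 0}$ (depending on $x$ but not on $i$) with $\sum_{k=0}^\infty q_k=1$, such that $$\sum_{k=0}^\infty q_k\min_{n\in\mathbb{N}\cap I_k}p(n)\;\le\; p(N_i)\;\le\;\sum_{k=0}^\infty q_k\max_{n\in\mathbb{N}\cap I_k}p(n)$$ for all $i\ge 0$. Here ''length of order $\sqrt{x}$'' means that for each fixed $k$ the length of $I_k=I_k(x)$ is of order $\sqrt{x}$ as $x\to\infty$, i.e. it lies between two positive constant multiples of $\sqrt{x}$ (the constants not depending on $x$) for all sufficiently large $x$.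
   Context: $\mathbb{N}=\{0,1,2,\ldots\}$. $[y]$ denotes $y$ rounded to the nearest integer. The values $p(0),\ldots,p(n_0)$ are given starting values; the later terms are determined by $p(n)=\mathbb{E}[p(Y(n))]$. *)

(* Defs.v *)
From mathcomp Require Import all_boot all_order all_algebra.
From mathcomp Require Import all_classical all_reals all_analysis.
Set Implicit Arguments.
Unset Strict Implicit.
Unset Printing Implicit Defensive.
Import Order.TTheory GRing.Theory Num.Theory.
Local Open Scope classical_set_scope.
Local Open Scope ring_scope.

(* Rounding of a nonnegative real to the nearest integer; ties are rounded
   up.  (Num.truncn agrees with the floor on nonnegative reals.) *)
Definition round_nat (R : realType) (y : R) : nat := Num.truncn (y + 2^-1).

(* A bounded interval with midpoint x; each endpoint may be included or not. *)
Definition centered_at (R : realType) (x : R) (J : interval R) : Prop :=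
  exists (r : R) (b1 b2 : bool),
    J = Interval (BSide b1 (x - r)) (BSide b2 (x + r)).

Definition itv_values (R : realType) (p : nat -> R) (J : interval R) : set R :=
  [set p n | n in [set n : nat | n%:R \in J]].

(* Minimum and maximum are required to be attained; in particular, A is
   nonempty as soon as either exists. *)
Definition is_min (R : realType) (A : set R) (m : R) : Prop :=
  A m /\ lbound A m.

Definition is_max (R : realType) (A : set R) (m : R) : Prop :=
  A m /\ ubound A m.

(* Main.v *)
Require Import Defs.
From mathcomp Require Import all_boot all_order all_algebra.
From mathcomp Require Import all_classical all_reals all_analysis.
From mathcomp Require Import ring lra.
Set Implicit Arguments.
Unset Strict Implicit.
Unset Printing Implicit Defensive.
Import Order.TTheory GRing.Theory Num.Theory.
Import numFieldNormedType.Exports.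
Local Open Scope classical_set_scope.
Local Open Scope ring_scope.

(** Starting from N_i, replace n by a copy of Y(n) again and again, stopping at
    the values n <= n0.  By p(n) = E[p(Y(n))], the expectation of p along this
    Markov chain stays equal to p(N_i).  Every step multiplies the position by
    alpha on average, so after i steps the chain sits near x, and it does so
    with a variance that is bounded by V(x) = A x + D, uniformly in i: if the
    mean squared distance to y = alpha^(j-i) x after j steps is s, then one
    more step makes the mean squared distance to alpha y at most
    kappa s + gamma y + const, with kappa < alpha.  As y itself shrinks only by
    the factor alpha, a bound of the form A y + D on s is preserved
    (iter_sqr_dist, descent_variance).

    By Chebyshev's inequality the chain is then outside the interval I_k of
    centre x and half-length sqrt (V(x) 2^(k+1)), whose length is of order
    sqrt x, with probability at most 2^-(k+1).  Since p <= M_k on I_k, where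
    M_k is the maximum over I_k and increases with k, the expectation of p is
    at most what one gets by putting mass 2^-(k+1) on M_k: the distribution of
    the first k with the chain in I_k is dominated by the geometric one
    (averaging_le_series).  The lower bound is the upper bound for -p.

    The chain itself is not constructed.  Its law after i steps enters through
    the functional f |-> E[f(chain)], which is linear, monotone and fixes
    constants (averaging): it is the i-th iterate of the one-step operator
    (descent), evaluated at N_i. *)

(** * Averaging functionals *)

(** An abstraction of f |-> E[f(X)] for a bounded random variable X with values
    in the natural numbers.  Unlike such variables, these functionals compose
    without any product construction: substituting a family of them into one
    gives another (see [averaging_iter]). *)
Record averaging (R : realType) (Lam : (nat -> R) -> R) : Prop := Averaging {
  averaging_lin : forall a f g,
    Lam (fun n => a * f n + g n) = a * Lam f + Lam g;
  averaging_le : forall f g, (forall n, f n <= g n) -> Lam f <= Lam g;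
  averaging_cst : forall c, Lam (fun=> c) = c }.

Section averaging_theory.
Variables (R : realType) (Lam : (nat -> R) -> R).
Hypothesis avLam : averaging Lam.

Lemma eq_averaging f g : f =1 g -> Lam f = Lam g.
Proof. by move=> fg; congr Lam; apply/funext. Qed.

Lemma averagingD f g : Lam (fun n => f n + g n) = Lam f + Lam g.
Proof.
rewrite -[Lam f]mul1r -(averaging_lin avLam).
by apply: eq_averaging => n; rewrite mul1r.
Qed.

Lemma averagingZ a f : Lam (fun n => a * f n) = a * Lam f.
Proof.
rewrite -[RHS]addr0 -[X in _ = _ + X](averaging_cst avLam 0).
rewrite -(averaging_lin avLam).
by apply: eq_averaging => n; rewrite addr0.
Qed.

Lemma averaging_sum K (c : nat -> R) (f : nat -> nat -> R) :
  Lam (fun n => \sum_(k < K) c k * f k n) = \sum_(k < K) c k * Lam (f k).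
Proof.
elim: K => [|K IH].
  rewrite big_ord0 -[RHS](averaging_cst avLam).
  by apply: eq_averaging => n; rewrite big_ord0.
rewrite big_ord_recr /= -IH addrC -(averaging_lin avLam).
by apply: eq_averaging => n; rewrite big_ord_recr /= addrC.
Qed.

(** Variance plus squared bias: the cross term vanishes at the mean [m]. *)
Lemma averaging_sqr_shift (y : R) (m := Lam (fun n => n%:R)) :
  Lam (fun n => (n%:R - y) ^+ 2) =
    Lam (fun n => (n%:R - m) ^+ 2) + (m - y) ^+ 2.
Proof.
pose s n : R := (n%:R - m) ^+ 2.
pose a := 2 * (m - y); pose c := (m - y) ^+ 2 - a * m.
have -> : Lam (fun n => (n%:R - y) ^+ 2) = Lam (fun n => a * n%:R + (s n + c)).
  by apply: eq_averaging => n; rewrite /s /c /a; ring.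
rewrite (averaging_lin avLam) averagingD (averaging_cst avLam) -/m /c /a /s.
by ring.
Qed.

(** Chebyshev's inequality: the indicator of distance more than [r] to [x] is
    at most the squared distance divided by [r ^+ 2]. *)
Lemma averaging_chebyshev (x r s : R) : 0 < r ->
  Lam (fun n => (n%:R - x) ^+ 2) <= s ->
  Lam (fun n => (~~ (`|n%:R - x| <= r))%:R) <= s / r ^+ 2.
Proof.
move=> r0 hs; rewrite mulrC.
apply: (@le_trans _ _ ((r ^+ 2)^-1 * Lam (fun n => (n%:R - x) ^+ 2)));
  last first.
  by rewrite ler_wpM2l// invr_ge0 sqr_ge0.
rewrite -averagingZ; apply: (averaging_le avLam) => n.
have [_|rn] := leP `|n%:R - x| r => /=.
  by rewrite mulr_ge0 ?sqr_ge0// invr_ge0 sqr_ge0.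
rewrite mulrC ler_pdivlMr ?exprn_gt0// mul1r -(real_normK (num_real (_ - x))).
by rewrite lerXn2r// ?nnegrE ?ltW.
Qed.

End averaging_theory.

Lemma sum_telescope (R : realType) (u : nat -> R) K :
  \sum_(k < K) (u k - u k.+1) = u 0%N - u K.
Proof.
elim: K => [|K IH]; first by rewrite big_ord0 subrr.
by rewrite big_ord_recr /= IH addrA subrK.
Qed.

(** Moving mass to later indices increases the mean of a nondecreasing
    sequence.  Think of [a] and [t] as the tails of two distributions; what
    they have left after [K] terms is charged at the value [B].  By Abel
    summation the difference of the two sides is a combination of the
    differences [t k - a k] with the nonnegative coefficients
    [c k - c k.-1] and, at [K], [B - c K.-1]. *)
Lemma ler_sum_weights (R : realType) (c a t : nat -> R) (B : R) K :
  nondecreasing_seq c -> (forall k, c k <= B) ->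
  a 0%N = t 0%N -> (forall k, a k <= t k) ->
  \sum_(k < K) c k * (a k - a k.+1) + B * a K
    <= \sum_(k < K) c k * (t k - t k.+1) + B * t K.
Proof.
move=> cnd cB a0 at_.
(* It suffices to treat the value [c K] in place of [B]: the induction then
   goes through, as each step changes the last value from [c K] to [c K.+1]. *)
have sK : \sum_(k < K) c k * (a k - a k.+1) + c K * a K
    <= \sum_(k < K) c k * (t k - t k.+1) + c K * t K.
  elim: K => [|K IH]; first by rewrite !big_ord0 a0.
  rewrite !big_ord_recr /=.
  have h : 0 <= (c K.+1 - c K) * (t K.+1 - a K.+1).
    by rewrite mulr_ge0// subr_ge0 ?cnd.
  by move: IH h; set X := \sum_(_ < _) _; set Z := \sum_(_ < _) _ => ? ?; nra.
have h : 0 <= (B - c K) * (t K - a K) by rewrite mulr_ge0// subr_ge0.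
move: sK h; by set X := \sum_(_ < _) _; set Z := \sum_(_ < _) _ => ? ?; nra.
Qed.

(** Each [n] is charged at the value [c k] of the first set [J k] that contains
    it, or at [B] if it is in none of the first [K] sets.  This majorizes [f],
    and the tails of the resulting distribution of [k] are bounded by [t]. *)
Lemma averaging_layers (R : realType) (Lam : (nat -> R) -> R) (f : nat -> R)
    (J : nat -> pred nat) (c t : nat -> R) (B : R) K :
  averaging Lam ->
  (forall k n, J k n -> J k.+1 n) ->
  (forall k n, J k n -> f n <= c k) -> (forall n, f n <= B) ->
  nondecreasing_seq c -> (forall k, c k <= B) ->
  t 0%N = 1 -> (forall k, Lam (fun n => (~~ J k n)%:R) <= t k.+1) ->
  Lam f <= \sum_(k < K) c k * (t k - t k.+1) + B * t K.
Proof.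
move=> av Jn fc fB cnd cB t0 Jt.
(* The indicator of lying in no [J j] with [j < k], by nestedness. *)
pose e k n : R := if k is k'.+1 then (~~ J k' n)%:R else 1.
have et k : Lam (e k) <= t k.
  by case: k => [|k]; rewrite /e ?(averaging_cst av) ?t0.
apply: le_trans (ler_sum_weights K cnd cB _ et); last first.
  by rewrite /e (averaging_cst av) t0.
rewrite -(averagingZ av).
under eq_bigr => k _.
  rewrite (_ : _ - _ = Lam (fun n => e k n - e k.+1 n)); last first.
    rewrite addrC -mulN1r -(averaging_lin av).
    by apply: eq_averaging => // n; rewrite mulN1r addrC.
  over.
rewrite -(averaging_sum av _ _ (fun k n => e k n - e k.+1 n)) -(averagingD av).
apply: (averaging_le av) => n /=.
(* [e 0 n = 1] splits into the layers [e k n - e k.+1 n] and the rest [e K n];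
   on the k-th layer [n] lies in [J k]. *)
have -> : f n = \sum_(k < K) f n * (e k n - e k.+1 n) + f n * e K n.
  by rewrite -big_distrr /= (sum_telescope (e ^~ n)) -mulrDr subrK mulr1.
apply: lerD; last first.
  by rewrite ler_wpM2r//; case: (K) => [|k] /=; rewrite ?ler01 ?ler0n.
apply: ler_sum => k _ /=; case: (boolP (J k n)) => [Jk|nJk] /=.
  rewrite ler_wpM2r ?fc// subr0.
  by case: (k : nat) => [|j] /=; rewrite ?ler01 ?ler0n.
suff -> : e k n = 1 by rewrite subrr !mulr0.
by case: (k : nat) nJk => [//|j] /= nJk; rewrite (contraNN (Jn j n) nJk).
Qed.

Lemma is_cvg_weighted_series (R : realType) (c t : nat -> R) (B : R) :
  nonincreasing_seq t -> cvgn t -> (forall k, `|c k| <= B) ->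
  cvgn (series (fun k => (t k - t k.+1) * c k)).
Proof.
move=> tni tcvg cB.
have q0 k : 0 <= t k - t k.+1 by rewrite subr_ge0 tni.
have B0 : 0 <= B by rewrite (le_trans _ (cB 0%N)).
have cvgt : cvgn (series (fun k => B * (t k - t k.+1))).
  rewrite (_ : series _ = (fun K => B * (t 0%N - t K))).
    by apply: is_cvgMr; apply: is_cvgB => //; exact: is_cvg_cst.
  apply/funext => K; rewrite /series /= big_mkord -big_distrr /=.
  by rewrite sum_telescope.
apply: normed_cvg; apply: series_le_cvg cvgt => k //=.
  by rewrite mulr_ge0.
by rewrite normrM ger0_norm// mulrC ler_wpM2r.
Qed.

(** The limit of [averaging_layers] as [K] grows: the mass [t K] charged at the
    bound [B] vanishes. *)
Lemma averaging_le_series (R : realType) (Lam : (nat -> R) -> R) (f : nat -> R)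
    (J : nat -> pred nat) (c t : nat -> R) (B : R) :
  averaging Lam ->
  (forall k n, J k n -> J k.+1 n) ->
  (forall k n, J k n -> f n <= c k) -> (forall n, `|f n| <= B) ->
  nondecreasing_seq c -> (forall k, `|c k| <= B) ->
  nonincreasing_seq t -> t 0%N = 1 -> t @ \oo --> (0 : R) ->
  (forall k, Lam (fun n => (~~ J k n)%:R) <= t k.+1) ->
  Lam f <= limn (series (fun k => (t k - t k.+1) * c k)).
Proof.
move=> av Jn fc fB cnd cB tni t0 tcvg Jt.
have cvgc := is_cvg_weighted_series tni (cvgP _ tcvg) cB.
have cvgBt : (fun K => series (fun k => (t k - t k.+1) * c k) K + B * t K)
    @ \oo --> limn (series (fun k => (t k - t k.+1) * c k)).
  rewrite -[X in _ --> X]addr0; apply: cvgD => //.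
  by rewrite -[X in _ --> X](mulr0 B); apply: cvgMr.
rewrite -(cvg_lim _ cvgBt)//; apply: limr_ge; first exact: cvgP cvgBt.
apply: nearW => K.
rewrite /series /= big_mkord; under eq_bigr do rewrite mulrC.
apply: (averaging_layers K av Jn fc) => // n.
- by rewrite (le_trans _ (fB n))// ler_norm.
- by rewrite (le_trans _ (cB n))// ler_norm.
Qed.

(** * Expectations of bounded variables *)

Section bounded_nat_variable.
Variables (R : realType) (d : measure_display) (T : measurableType d).
Variables (P : probability T R) (X : {RV P >-> nat}) (b : nat).
Hypothesis X_lt : forall w, (X w < b)%N.

Lemma integrable_comp_nat (f : nat -> R) :
  P.-integrable setT (EFin \o (fun w => f (X w))).
Proof.
apply: measurable_bounded_integrable => //.
- by rewrite -ge0_fin_numE// fin_num_measure.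
- exact: (measurableT_comp (f := f)).
exists (\sum_(k < b) `|f k|); split; first exact: num_real.
move=> M ltM w _ /=; apply: le_trans (ltW ltM).
by rewrite (bigD1 (Ordinal (X_lt w)))//= lerDl sumr_ge0.
Qed.

Lemma averaging_Rintegral : averaging (fun f => \int[P]_w f (X w)).
Proof.
split=> [a f g|f g fg|c].
- rewrite RintegralD//.
  + by rewrite RintegralZl//; exact: integrable_comp_nat.
  + exact: (integrable_comp_nat (fun n => a * f n)).
  + exact: integrable_comp_nat.
- apply: le_Rintegral => //; exact: integrable_comp_nat.
- rewrite Rintegral_cst// (_ : fine _ = 1) ?mulr1//.
  exact: (congr1 fine (probability_setT P)).
Qed.

Lemma expectation_comp_nat (f : nat -> R) :
  ('E_P[fun w => f (X w)] = (\int[P]_w f (X w))%:E)%E.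
Proof.
rewrite unlock /Rintegral fineK//.
exact/integrable_fin_num/integrable_comp_nat.
Qed.

(** Variance plus squared bias, where [mu] is an approximation of the mean with
    error at most [beta]. *)
Lemma Rintegral_sqr_dist (mu beta v y : R) :
  (`| 'E_P[fun w => (X w)%:R] - mu%:E | <= beta%:E)%E ->
  ('V_P[fun w => (X w)%:R] <= v%:E)%E ->
  \int[P]_w ((X w)%:R - y) ^+ 2 <= v + (`|mu - y| + beta) ^+ 2.
Proof.
have av := averaging_Rintegral.
rewrite /variance [@covariance]unlock.
rewrite (expectation_comp_nat (fun n => n%:R)) /= lee_fin.
set m := \int[P]_w _ => hm.
rewrite (_ : (_ * _) = (fun w => ((X w)%:R - m) ^+ 2)); last first.
  by apply/funext => w; rewrite expr2.
rewrite (expectation_comp_nat (fun n => (n%:R - m) ^+ 2)) lee_fin => hv.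
have -> := averaging_sqr_shift av y; rewrite -/m.
apply: lerD => //; rewrite -(real_normK (num_real (m - y))) lerXn2r// ?nnegrE//.
  by rewrite addr_ge0// (le_trans _ hm).
rewrite (_ : m - y = (mu - y) + (m - mu)); last by ring.
by rewrite (le_trans (ler_normD _ _))// lerD.
Qed.

End bounded_nat_variable.

(** * Evolution of the mean squared distance *)

(** With [u] the distance of [n] to [y], the left-hand side bounds the mean
    squared distance of [Y n] to [alpha * y].  The coefficient of [u ^+ 2] is
    [alpha ^+ 2], and the terms linear in [u], coming from the drift error
    [beta] and from [gamma * n <= gamma * y + gamma * u], are absorbed into the
    square at the price of increasing this coefficient.  It can be kept below
    [alpha] because [alpha ^+ 2 < alpha]. *)
Lemma quadratic_drift (R : realType) (alpha beta gamma delta : R) :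
  0 < alpha -> alpha < 1 -> 0 <= gamma -> 0 <= delta ->
  exists kappa delta', [/\ 0 <= kappa, kappa < alpha, 0 <= delta' &
    forall n y u, n <= y + u ->
      gamma * n + delta + (alpha * u + beta) ^+ 2
        <= kappa * u ^+ 2 + gamma * y + delta'].
Proof.
move=> a0 a1 g0 d0.
(* With this [eta], [alpha ^+ 2 + eta] is halfway between [alpha ^+ 2] and
   [alpha]; [b] is the coefficient of the linear term. *)
pose eta := alpha * (1 - alpha) / 2; pose b := gamma + 2 * alpha * beta.
have eta0 : 0 < eta by rewrite /eta; nra.
exists (alpha ^+ 2 + eta), (delta + beta ^+ 2 + eta * (b / (2 * eta)) ^+ 2).
split.
- by rewrite addr_ge0 ?sqr_ge0// ltW.
- by rewrite /eta; nra.
- by rewrite !addr_ge0 ?sqr_ge0// mulr_ge0 ?sqr_ge0// ltW.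
- move=> n y u nyu.
  have h : 0 <= gamma * (y + u - n) by rewrite mulr_ge0// subr_ge0.
  have : 0 <= eta * (u - b / (2 * eta)) ^+ 2 by rewrite mulr_ge0 ?sqr_ge0// ltW.
  have -> : eta * (u - b / (2 * eta)) ^+ 2 =
      eta * u ^+ 2 - b * u + eta * (b / (2 * eta)) ^+ 2.
    by field; rewrite gt_eqF.
  set q := b / _; have -> : b = gamma + 2 * alpha * beta by [].
  by move=> ?; lra.
Qed.

(** The coefficients [A] and [D] for which the bound [A * y + D] is carried over
    from [y] to [alpha * y] by the recursion of [quadratic_drift]. *)
Lemma variance_bound (R : realType) (alpha kappa gamma delta : R) :
  0 <= kappa -> kappa < alpha -> alpha < 1 -> 0 <= gamma -> 0 <= delta ->
  exists A D, [/\ 0 < A, 1 <= D, kappa * A + gamma <= alpha * A &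
    kappa * D + delta <= D].
Proof.
move=> k0 ka a1 g0 d0.
have ak : 0 < alpha - kappa by lra.
have k1 : 0 < 1 - kappa by lra.
exists (gamma / (alpha - kappa) + 1), (delta / (1 - kappa) + 1).
have : 0 <= gamma / (alpha - kappa) by rewrite divr_ge0// ltW.
have : 0 <= delta / (1 - kappa) by rewrite divr_ge0// ltW.
have : (alpha - kappa) * (gamma / (alpha - kappa)) = gamma.
  by rewrite mulrC divfK// gt_eqF.
have : (1 - kappa) * (delta / (1 - kappa)) = delta.
  by rewrite mulrC divfK// gt_eqF.
set a := _ / (alpha - _); set b := _ / (1 - _) => hb ha b0 a0.
by split; lra.
Qed.

Section averaging_iteration.
Variables (R : realType) (L : (nat -> R) -> nat -> R).
Hypothesis avL : forall n, averaging (fun f => L f n).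

Lemma averaging_iter i N : averaging (fun f => iter i L f N).
Proof.
elim: i => [|i [lin le cst]]; first by split.
split=> [a f g|f g fg|c]; rewrite !iterSr.
- rewrite -lin; congr (iter i L _ N); apply/funext => n.
  exact: (averaging_lin (avL n)).
- by apply: le => n; exact: (averaging_le (avL n)).
- rewrite -[RHS]cst; congr (iter i L _ N); apply/funext => n.
  exact: (averaging_cst (avL n)).
Qed.

(** The centre [alpha ^+ i * z] follows the mean of the chain.  The step is
    added at the end of the chain, so that the bound proved so far enters with
    the contraction factor [kappa].  Because [kappa < alpha], the noise
    [gamma * y] of all steps adds up to a multiple of the current [y], with no
    factor that grows with [i]. *)
Lemma iter_sqr_dist (alpha kappa gamma delta A D z : R) i N :
  0 <= alpha -> 0 <= kappa ->
  (forall n y, L (fun m => (m%:R - alpha * y) ^+ 2) n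
      <= kappa * (n%:R - y) ^+ 2 + (gamma * y + delta)) ->
  kappa * A + gamma <= alpha * A -> kappa * D + delta <= D ->
  0 <= z -> (N%:R - z) ^+ 2 <= A * z + D ->
  iter i L (fun n => (n%:R - alpha ^+ i * z) ^+ 2) N
    <= A * (alpha ^+ i * z) + D.
Proof.
move=> a0 k0 step hA hD z0 hN; elim: i => [|i IH].
  by rewrite expr0 mul1r.
have av := averaging_iter i N.
rewrite iterSr exprS -mulrA; set y := _ * z in IH *.
have y0 : 0 <= y by rewrite mulr_ge0// exprn_ge0.
apply: le_trans (averaging_le av (fun n => step n y)) _.
rewrite (averaging_lin av kappa (fun n => (n%:R - y) ^+ 2)) (averaging_cst av).
have := ler_wpM2l k0 IH; have := ler_wpM2r y0 hA.
by set s := iter _ _ _ _ => ? ?; nra.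
Qed.

End averaging_iteration.

Lemma round_nat_dist (R : realType) (z : R) : 0 <= z ->
  `|(round_nat z)%:R - z| <= 2^-1.
Proof.
move=> z0; have /truncn_itv : 0 <= z + 2^-1 by rewrite addr_ge0// invr_ge0.
rewrite /round_nat; set k := Num.truncn _.
rewrite -[k.+1%:R]natr1 ler_distl => /andP[h1 h2].
by apply/andP; split; lra.
Qed.

Lemma round_nat_sqr_dist (R : realType) (z : R) : 0 <= z ->
  ((round_nat z)%:R - z) ^+ 2 <= 1.
Proof.
move=> z0; rewrite -(real_normK (num_real (_ - z))) exprn_ile1//.
by rewrite (le_trans (round_nat_dist z0))//; lra.
Qed.

(** * Intervals and weights *)

Lemma exists_argmax (R : realType) (p : nat -> R) (Q : pred nat) (b n0 : nat) :
  Q n0 -> (forall n, Q n -> (n <= b)%N) ->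
  exists2 n, Q n & forall m, Q m -> p m <= p n.
Proof.
move=> Q0 Qb; pose i0 : 'I_b.+1 := Ordinal (Qb _ Q0 : (n0 < b.+1)%N).
have [i Qi imax] := @arg_maxP _ _ _ i0 (fun i => Q i) (fun i => p i) Q0.
exists (i : nat) => // m Qm.
exact: (imax (Ordinal (Qb _ Qm : (m < b.+1)%N))).
Qed.

(** [V] is meant to bound the mean squared distance to [x]; the half-lengths are
    chosen so that Chebyshev's inequality gives the tail [2^-1 ^+ k.+1]. *)
Definition window (R : realType) (V : R -> R) (x : R) (k : nat) : interval R :=
  `[x - Num.sqrt (V x * 2 ^+ k.+1), x + Num.sqrt (V x * 2 ^+ k.+1)].

Section windows.
Variables (R : realType) (V : R -> R) (x : R).
Hypothesis V_ge1 : 1 <= V x.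

Let half k : R := Num.sqrt (V x * 2 ^+ k.+1).

Lemma in_window (y : R) k : (y \in window V x k) = (`|y - x| <= half k).
Proof. by rewrite in_itv /= ler_distl. Qed.

Lemma half_ge1 k : 1 <= half k.
Proof.
rewrite -sqrtr1 ler_wsqrtr// (le_trans V_ge1)// ler_peMr ?(le_trans ler01)//.
by rewrite exprn_ege1// ler1n.
Qed.

Lemma sqr_half k : half k ^+ 2 = V x * 2 ^+ k.+1.
Proof. by rewrite sqr_sqrtr// mulr_ge0 ?exprn_ge0// (le_trans ler01). Qed.

Lemma window_nested k : {subset window V x k <= window V x k.+1}.
Proof.
move=> y; rewrite !in_window => /le_trans; apply.
rewrite ler_wsqrtr// ler_wpM2l ?(le_trans ler01)//.
by rewrite [leRHS]exprS ler_peMl ?exprn_ge0// ler1n.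
Qed.

Lemma window_centered k : centered_at x (window V x k).
Proof. by exists (half k), true, false. Qed.

Lemma window_measure k :
  lebesgue_measure [set` window V x k] = (2 * half k)%:E.
Proof.
have h0 := lt_le_trans ltr01 (half_ge1 k).
rewrite lebesgue_measure_itv /= lte_fin ifT; last by rewrite -/(half k); lra.
by rewrite -EFinB -/(half k); congr _%:E; lra.
Qed.

Lemma averaging_window (Lam : (nat -> R) -> R) k : averaging Lam ->
  Lam (fun n => (n%:R - x) ^+ 2) <= V x ->
  Lam (fun n => (~~ (n%:R \in window V x k))%:R) <= 2^-1 ^+ k.+1.
Proof.
move=> av hV; have h0 := lt_le_trans ltr01 (half_ge1 k).
apply: le_trans (_ : V x / half k ^+ 2 <= _).
  have := averaging_chebyshev av h0 hV; congr (_ <= _).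
  by apply: eq_averaging => n; rewrite in_window.
rewrite sqr_half invfM mulrA divff ?mul1r ?exprVn//.
by rewrite gt_eqF// (lt_le_trans ltr01).
Qed.

(** Half-length at least 1 makes the window contain the integer nearest to its
    centre, so that the extrema over its integers exist. *)
Lemma window_argmax (p : nat -> R) k : 0 <= x ->
  exists n, n%:R \in window V x k /\
    forall m : nat, m%:R \in window V x k -> p m <= p n.
Proof.
move=> x0; have h1 := half_ge1 k.
have [||n Qn nmax] := @exists_argmax R p
  (fun n => n%:R \in window V x k) (Num.truncn (x + half k)) (round_nat x).
- by rewrite in_window (le_trans (round_nat_dist x0))//; lra.
- move=> n; rewrite in_window ler_distl => /andP[_ hn].
  by rewrite truncn_ge_nat//; lra.
by exists n.
Qed.

End windows.

Lemma window_max (R : realType) (V : R -> R) (p : nat -> R) (x : R) :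
  1 <= V x -> 0 <= x ->
  exists M, forall k, is_max (itv_values p (window V x k)) (M k).
Proof.
move=> V1 x0; suff /choice[f fP] : forall k, exists y,
  is_max (itv_values p (window V x k)) y by exists f.
move=> k.
have [n [Qn nmax]] := window_argmax V1 p k x0.
by exists (p n); split; [exists n|move=> _ [m Qm <-]; exact: nmax].
Qed.

Lemma window_min (R : realType) (V : R -> R) (p : nat -> R) (x : R) :
  1 <= V x -> 0 <= x ->
  exists m, forall k, is_min (itv_values p (window V x k)) (m k).
Proof.
move=> V1 x0; suff /choice[f fP] : forall k, exists y,
  is_min (itv_values p (window V x k)) y by exists f.
move=> k.
have [n [Qn nmax]] := window_argmax V1 (fun n => - p n) k x0.
exists (p n); split; first by exists n.
by move=> _ [m Qm <-]; rewrite -lerN2; exact: nmax.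
Qed.

(** This is [2^-1 ^+ k.+1] (see [weightE]), written as a difference of the
    tails to which Chebyshev's inequality is compared. *)
Definition weight (R : realType) k : R := 2^-1 ^+ k - 2^-1 ^+ k.+1.

Lemma half_expr_nonincreasing (R : realType) :
  nonincreasing_seq (fun k => 2^-1 ^+ k : R).
Proof.
apply/nonincreasing_seqP => k.
by rewrite exprS ler_piMl ?exprn_ge0 ?invr_ge0//; lra.
Qed.

Lemma half_expr_cvg (R : realType) : (fun k => 2^-1 ^+ k : R) @ \oo --> (0 : R).
Proof. by apply: cvg_expr; rewrite ger0_norm ?invr_ge0//; lra. Qed.

Lemma averaging_window_max (R : realType) (V : R -> R) (p : nat -> R) (x B : R)
    (M : nat -> R) (Lam : (nat -> R) -> R) :
  1 <= V x -> (forall n, `|p n| <= B) -> averaging Lam ->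
  Lam (fun n => (n%:R - x) ^+ 2) <= V x ->
  (forall k, is_max (itv_values p (window V x k)) (M k)) ->
  Lam p <= limn (series (fun k => weight R k * M k)).
Proof.
move=> V1 pB av hV Mmax.
apply: (@averaging_le_series R Lam p (fun k n => n%:R \in window V x k) M
   (fun k => 2^-1 ^+ k) B) => //.
- by move=> k n; exact: window_nested.
- by move=> k n nk; apply: (Mmax k).2; exists n.
- apply/nondecreasing_seqP => k; apply: (Mmax k.+1).2.
  by have [n nk <-] := (Mmax k).1; exists n => //; exact: window_nested.
- by move=> k; have [n _ <-] := (Mmax k).1.
- exact: half_expr_nonincreasing.
- exact: half_expr_cvg.
- by move=> k; exact: averaging_window.
Qed.

(** The minima of [p] are the maxima of [- p], up to sign. *)
Lemma averaging_window_min (R : realType) (V : R -> R) (p : nat -> R) (x B : R)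
    (m : nat -> R) (Lam : (nat -> R) -> R) :
  1 <= V x -> (forall n, `|p n| <= B) -> averaging Lam ->
  Lam (fun n => (n%:R - x) ^+ 2) <= V x ->
  (forall k, is_min (itv_values p (window V x k)) (m k)) ->
  limn (series (fun k => weight R k * m k)) <= Lam p.
Proof.
move=> V1 pB av hV mmin.
have cm : cvgn (series (fun k => weight R k * m k)).
  apply: (@is_cvg_weighted_series R m (fun k => 2^-1 ^+ k) B).
  - exact: half_expr_nonincreasing.
  - exact: cvgP (@half_expr_cvg R).
  - by move=> k; have [n _ <-] := (mmin k).1.
rewrite -lerN2 -limN// (_ : - series _ = series (fun k => weight R k * - m k)).
  rewrite (_ : - Lam p = Lam (fun n => - p n)).
    apply: (averaging_window_max V1 (B := B)) => // [n|k]; first by rewrite normrN.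
    split; first by have [n nk <-] := (mmin k).1; exists n.
    by move=> _ [n nk <-]; rewrite lerN2; apply: (mmin k).2; exists n.
  rewrite -mulN1r -(averagingZ av).
  by apply: eq_averaging => n; rewrite mulN1r.
apply/funext => K; rewrite [RHS]/series /=.
by under eq_bigr do rewrite mulrN; rewrite sumrN.
Qed.

Lemma weightE (R : realType) k : weight R k = 2^-1 ^+ k.+1.
Proof. by rewrite /weight exprS; lra. Qed.

Lemma weight_gt0 (R : realType) k : 0 < weight R k.
Proof. by rewrite weightE exprn_gt0 ?invr_gt0. Qed.

Lemma weight_decreasing (R : realType) : decreasing_seq (weight R).
Proof.
apply/decreasing_seqP => k; rewrite [ltLHS]weightE exprS -weightE.
by have := weight_gt0 R k; lra.
Qed.

Lemma weight_sum (R : realType) : series (weight R) @ \oo --> (1 : R).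
Proof.
rewrite (_ : series _ = (fun K => 1 - 2^-1 ^+ K)).
  rewrite -[X in _ --> X]subr0; apply: cvgB; first exact: cvg_cst.
  exact: half_expr_cvg.
apply/funext => K; rewrite /series /= big_mkord.
exact: (sum_telescope (fun k => 2^-1 ^+ k)).
Qed.

(** * The descending chain *)

(** The transition operator of the chain.  The states [n <= n0], where nothing
    is known about [Y n], are made absorbing. *)
Definition descent (R : realType) (n0 : nat) (d : nat -> measure_display)
    (T : forall n, measurableType (d n)) (P : forall n, probability (T n) R)
    (Y : forall n, {RV (P n) >-> nat}) (f : nat -> R) (n : nat) : R :=
  if (n0 < n)%N then \int[P n]_w f (Y n w) else f n.

Section descent_theory.
Variables (R : realType) (alpha beta gamma delta : R) (n0 : nat).
Variables (d : nat -> measure_display) (T : forall n, measurableType (d n)).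
Variables (P : forall n, probability (T n) R).
Variables (Y : forall n, {RV (P n) >-> nat}).
Hypotheses (alpha_gt0 : 0 < alpha) (alpha_lt1 : alpha < 1).
Hypotheses (beta_ge0 : 0 <= beta) (gamma_ge0 : 0 <= gamma).
Hypothesis delta_ge0 : 0 <= delta.
Hypothesis Y_lt : forall n, (n0 < n)%N -> forall w, (Y n w < n)%N.

Lemma averaging_descent n : averaging (fun f => descent n0 Y f n).
Proof.
rewrite /descent; case: ltnP => [n0n|_]; last by split.
exact: averaging_Rintegral (Y_lt n0n).
Qed.

(** The recurrence for [p] says that [p] is harmonic for the chain, hence equal
    to its mean after any number of steps. *)
Lemma descent_harmonic (p : nat -> R) :
  (forall n, (n0 < n)%N -> (p n)%:E = 'E_(P n)[fun w => p (Y n w)]%E) ->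
  forall i, iter i (descent n0 Y) p = p.
Proof.
move=> p_rec; elim=> [//|i IH]; rewrite iterS IH; apply/funext => n.
rewrite /descent; case: ltnP => // n0n.
by apply: EFin_inj; rewrite p_rec// (expectation_comp_nat (Y_lt n0n)).
Qed.

Hypothesis Y_mean : forall n, (n0 < n)%N ->
  (`| 'E_(P n)[fun w => (Y n w)%:R] - (alpha * n%:R)%:E | <= beta%:E)%E.
Hypothesis Y_var : forall n, (n0 < n)%N ->
  ('V_(P n)[fun w => (Y n w)%:R] <= (gamma * n%:R + delta)%:E)%E.

(** Staying at a state [n <= n0] instead of moving to about [alpha * n] is a
    drift error of at most [n0], whence the correction of [beta]. *)
Lemma descent_sqr_dist n y :
  descent n0 Y (fun m => (m%:R - alpha * y) ^+ 2) n
    <= gamma * n%:R + delta + (alpha * `|n%:R - y| + (beta + n0%:R)) ^+ 2.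
Proof.
have n00 : (0 : R) <= n0%:R by [].
have u0 : 0 <= alpha * `|n%:R - y| by rewrite mulr_ge0// ltW.
rewrite /descent; case: ltnP => [n0n|nn0].
  apply: le_trans (Rintegral_sqr_dist (Y_lt n0n) _ (Y_mean n0n) (Y_var n0n)) _.
  rewrite lerD2l -mulrBr normrM (gtr0_norm alpha_gt0).
  by rewrite lerXn2r// ?nnegrE ?addr_ge0// lerD2l lerDl.
have nn0R : n%:R <= n0%:R :> R by rewrite ler_nat.
have n_ge0 : (0 : R) <= n%:R by [].
rewrite -[leLHS]add0r lerD ?addr_ge0 ?mulr_ge0//.
rewrite -(real_normK (num_real (n%:R - _))) lerXn2r// ?nnegrE ?addr_ge0//.
rewrite (_ : n%:R - _ = alpha * (n%:R - y) + (1 - alpha) * n%:R); last by ring.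
rewrite (le_trans (ler_normD _ _))// normrM (gtr0_norm alpha_gt0) lerD2l.
have a1 : 0 <= 1 - alpha by rewrite subr_ge0 ltW.
rewrite ger0_norm ?mulr_ge0// (le_trans (_ : _ <= n%:R))//.
  by rewrite ler_piMl// lerBlDr lerDl ltW.
by rewrite (le_trans nn0R)// lerDr.
Qed.

(** The chain starts within distance 1 of [alpha ^- i * x], and the bound at the
    end of its [i] steps depends on [x] only. *)
Lemma descent_variance : exists2 V : R -> R,
  exists A D, [/\ 0 < A, 1 <= D & forall x, V x = A * x + D] &
  forall x i, 0 < x ->
    iter i (descent n0 Y) (fun n => (n%:R - x) ^+ 2)
      (round_nat (alpha ^- i * x)) <= V x.
Proof.
have [kappa [delta' [k0 ka d0 drift]]] :=
  quadratic_drift (beta + n0%:R) alpha_gt0 alpha_lt1 gamma_ge0 delta_ge0.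
have [A [D [A0 D1 hA hD]]] := variance_bound k0 ka alpha_lt1 gamma_ge0 d0.
exists (fun x => A * x + D); first by exists A, D.
move=> x i x0; set N := round_nat _.
have ai0 : 0 < alpha ^+ i by rewrite exprn_gt0.
have z0 : 0 <= alpha ^- i * x by rewrite mulr_ge0 ?invr_ge0 ?ltW.
have {1 2}-> : x = alpha ^+ i * (alpha ^- i * x).
  by rewrite mulrA divff ?mul1r// gt_eqF.
apply: (@iter_sqr_dist R _ averaging_descent alpha kappa gamma delta') => //.
- exact: ltW.
- move=> n y; apply: le_trans (descent_sqr_dist n y) _.
  rewrite -(real_normK (num_real (n%:R - y))) [leRHS]addrA; apply: drift.
  by rewrite -lerBlDl ler_norm.
- rewrite (le_trans (round_nat_sqr_dist z0))// (le_trans D1)// lerDr.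
  by rewrite mulr_ge0// ltW.
Qed.

End descent_theory.

(** * Extremal bounds on nested intervals *)

Theorem theorem1 (R : realType) (alpha beta gamma delta : R) (n0 : nat)
    (p : nat -> R)
    (d : nat -> measure_display) (T : forall n, measurableType (d n))
    (P : forall n, probability (T n) R)
    (Y : forall n, {RV (P n) >-> nat})
    (alpha_gt0 : 0 < alpha) (alpha_lt1 : alpha < 1)
    (beta_ge0 : 0 <= beta) (gamma_ge0 : 0 <= gamma) (delta_ge0 : 0 <= delta)
    (p_bounded : bounded_fun p)
    (Y_lt : forall n, (n0 < n)%N -> forall w, (Y n w < n)%N)
    (p_rec : forall n, (n0 < n)%N -> (p n)%:E = 'E_(P n)[fun w => p (Y n w)]%E)
    (Y_mean : forall n, (n0 < n)%N ->
      (`| 'E_(P n)[fun w => (Y n w)%:R] - (alpha * n%:R)%:E | <= beta%:E)%E)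
    (Y_var : forall n, (n0 < n)%N ->
      ('V_(P n)[fun w => (Y n w)%:R] <= (gamma * n%:R + delta)%:E)%E) :
  exists (I : R -> nat -> interval R) (q : R -> nat -> R),
    (forall x : R, 0 < x ->
      [/\ forall k, {subset I x k <= I x k.+1},
          forall k, centered_at x (I x k),
          (forall k, 0 < q x k) /\ decreasing_seq (q x),
          series (q x) @ \oo --> (1 : R) &
          exists m M : nat -> R,
            [/\ forall k, is_min (itv_values p (I x k)) (m k),
                forall k, is_max (itv_values p (I x k)) (M k) &
                forall i : nat,
                  limn (series (fun k => q x k * m k))
                    <= p (round_nat (alpha ^- i * x))
                    <= limn (series (fun k => q x k * M k))]]) /\
    (forall k, exists c C : R, [/\ 0 < c, 0 < C &
      \forall x \near +oo,
        ((c * Num.sqrt x)%:E <= lebesgue_measure [set` I x k]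
           <= (C * Num.sqrt x)%:E)%E]).
Proof.
have [V [A [D [A0 D1 VE]]] hV] := descent_variance alpha_gt0 alpha_lt1
  beta_ge0 gamma_ge0 delta_ge0 Y_lt Y_mean Y_var.
have [B pB] : exists B, forall n, `|p n| <= B.
  have [B [_ hB]] := p_bounded; exists (B + 1) => n.
  by apply: hB => //; rewrite ltrDl.
exists (window V), (fun=> weight R); split=> [x x0|k].
  have V1 : 1 <= V x.
    by rewrite VE -[leLHS]add0r lerD// mulr_ge0// ltW.
  have [m mP] := window_min p V1 (ltW x0).
  have [M MP] := window_max p V1 (ltW x0).
  split.
  - exact: window_nested.
  - exact: window_centered.
  - split; first exact: weight_gt0.
    exact: weight_decreasing.
  - exact: weight_sum.
  exists m, M; split=> // i.
  have av := averaging_iter (averaging_descent Y_lt) i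
    (round_nat (alpha ^- i * x)).
  have := hV x i x0; set N := round_nat _ in av * => hN.
  have -> : p N = iter i (descent n0 Y) p N by rewrite (descent_harmonic Y_lt).
  apply/andP; split.
    exact: (averaging_window_min V1 pB av hN).
  exact: (averaging_window_max V1 pB av hN).
exists (2 * Num.sqrt (A * 2 ^+ k.+1)), (2 * Num.sqrt ((A + D) * 2 ^+ k.+1)).
have k0 : 0 < 2 ^+ k.+1 :> R by rewrite exprn_gt0.
have AD : 0 < A + D by lra.
split; try by rewrite mulr_gt0// sqrtr_gt0 mulr_gt0.
near=> x.
have x1 : 1 <= x by near: x; exact: nbhs_pinfty_ge.
have V1 : 1 <= V x by rewrite VE; nra.
rewrite window_measure// !lee_fin -!mulrA !ler_pM2l// -!sqrtrM; last 2 first.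
- by rewrite mulr_ge0// ltW.
- by rewrite mulr_ge0// ltW.
rewrite VE !ler_wsqrtr// mulrAC ler_pM2r//; nra.
Unshelve. all: by end_near.
Qed.
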